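(* Let $\widetilde V$ be a real vector space with $\dim\widetilde V=\tilde n<\infty$, let $\mathtt c$ be a symmetric positive semi-definite bilinear form on $\widetilde V$ with $s:=\dim\ker\mathtt c<\tilde n$, and let $\mathtt b$ be a symmetric (possibly indefinite) bilinear form on $\widetilde V$ which, if $s\ge1$, is positive definite on $\ker\mathtt c$. Let $\lambda_1\le\dots\le\lambda_{\tilde n-s}$ and $p_1,\dots,p_{\tilde n-s}$ be the finite eigenvalues and $\mathtt c$-orthonormal eigenvectors of the generalised eigenvalue problem $\mathtt b(p,v)=\lambda\mathtt c(p,v)$ for all $v\in\widetilde V$, as specified in the context. Suppose that there exists $m\in\{1,\dots,\tilde n-s-1\}$ such that $\lambda_{m+1}>0$, and define $$\Pi v=\sum_{j=1}^m\mathtt c(v,p_j)\,p_j\qquad\text{for all }v\in\widetilde V.$$ Then, for all $v\in\widetilde V$, $$\mathtt c(v-\Pi v,v-\Pi v)\le\frac1{\lambda_{m+1}}\,\mathtt b(v-\Pi v,v-\Pi v).$$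
   Context: $\ker\mathtt c=\{v\in\widetilde V:\mathtt c(v,w)=0\ \forall w\in\widetilde V\}$. Under the stated hypotheses $\widetilde V$ has a basis $p_1,\dots,p_{\tilde n}$ such that $p_1,\dots,p_{\tilde n-s}$ satisfy $\mathtt b(p_j,v)=\lambda_j\mathtt c(p_j,v)$ for all $v\in\widetilde V$ with real $\lambda_1\le\dots\le\lambda_{\tilde n-s}$, the vectors $p_{\tilde n-s+1},\dots,p_{\tilde n}$ form a basis of $\ker\mathtt c$, and $\mathtt c(p_j,p_{j'})=\delta_{j,j'}$, $\mathtt b(p_j,p_{j'})=\lambda_j\delta_{j,j'}$ for $j\in\{1,\dots,\tilde n-s\}$, $j'\in\{1,\dots,\tilde n\}$. The $p_j$ and $\lambda_j$ in the claim are from such a basis. *)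

(* Defs.v *)
From HB Require Import structures.
From mathcomp Require Import all_boot all_order all_algebra.
From mathcomp Require Import sesquilinear reals.
Set Implicit Arguments.
Unset Strict Implicit.
Unset Printing Implicit Defensive.
Import Order.TTheory GRing.Theory Num.Theory.
Local Open Scope ring_scope.

Definition form_ker (R : realType) (V : vectType R) (c : {symmetric V}) :
  {vspace V} := orthov c fullv.

(* The library's orthov is built from a basis of its argument; this gives
   back ker c = {v | c(v,w) = 0 for all w}. *)
Lemma form_kerP (R : realType) (V : vectType R) (c : {symmetric V}) (v : V) :
  reflect (forall w, c v w = 0) (v \in form_ker c).
Proof.
apply: (iffP mem_orthovP) => [h w|h w _]; last exact: h.
by apply: h; rewrite memvf.
Qed.

(* Sequences are indexed from 0: lam`_j and p`_j are the mathematical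
   lambda_(j+1) and p_(j+1). The sequence lam lists only the n - s finite
   eigenvalues, and drop (n - s) p is p_(n-s+1), ..., p_n. *)
Record gen_eigenbasis (R : realType) (V : vectType R) (b c : {symmetric V})
    (n s : nat) (lam : (n - s).-tuple R) (p : n.-tuple V) : Prop := {
  geb_basis : basis_of fullv p;
  geb_sorted : sorted <=%R lam;
  geb_eigen : forall j : nat, (j < n - s)%N ->
    forall v : V, b p`_j v = lam`_j * c p`_j v;
  geb_ker : basis_of (form_ker c) (drop (n - s) p);
  geb_c : forall j k : nat, (j < n - s)%N -> (k < n)%N ->
    c p`_j p`_k = (j == k)%:R;
  geb_b : forall j k : nat, (j < n - s)%N -> (k < n)%N ->
    b p`_j p`_k = lam`_j * (j == k)%:R
}.

Definition eig_proj (R : realType) (V : vectType R) (c : {symmetric V})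
    (p : seq V) (m : nat) (v : V) : V :=
  \sum_(j < m) c v p`_j *: p`_j.

(* Main.v *)
Require Import Defs.
From mathcomp Require Import all_boot all_order all_algebra.
From mathcomp Require Import sesquilinear reals.
Import Order.TTheory GRing.Theory Num.Theory.
Local Open Scope ring_scope.
Set Implicit Arguments.
Unset Strict Implicit.

(** In coordinates the inequality is a term-by-term comparison. Write
    N = n - s, let w be any vector, and split it as w = e + k with
    e the sum of the c(w, p_j) p_j over j < N. Pairing k with each basis vector
    shows that k lies in ker c, so by c-orthonormality
      c(w, w) = sum over j < N of c(w, p_j)^2                  ([c_diagE]).
    The eigenvector equation b(p_j, k) = lambda_j c(p_j, k) = 0 makes e and k
    orthogonal for b as well, so
      b(w, w) = sum over j < N of lambda_j c(w, p_j)^2 + b(k, k)  ([b_diagE]),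
    and b(k, k) >= 0 by definiteness of b on ker c. For w = v - Pi v the
    coefficients c(w, p_j) with j < m vanish; the others carry eigenvalues
    lambda_j >= lambda_(m+1), the least of them (entry m of the 0-based
    sequence). Hence lambda_(m+1) c(w, w) <= b(w, w), and one divides by
    lambda_(m+1) > 0. *)

Lemma symmetric_formC (R : realType) (V : vectType R) (f : {symmetric V})
    (u v : V) : f u v = f v u.
Proof. by rewrite hermC /= expr0 mul1r. Qed.

Lemma eig_proj_forml (R : realType) (V : vectType R) (c f : {symmetric V})
    (p : seq V) (m : nat) (v w : V) :
  f (eig_proj c p m v) w = \sum_(j < m) c v p`_j * f p`_j w.
Proof.
by rewrite /eig_proj linear_sumlz; apply: eq_bigr => j _; rewrite linearZl_LR.
Qed.

Lemma c_ker_tail (R : realType) (V : vectType R) (b c : {symmetric V})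
    (n s : nat) (lam : (n - s).-tuple R) (p : n.-tuple V)
    (hp : gen_eigenbasis b c lam p) (i : nat) (v : V) :
  (n - s <= i < n)%N -> c v p`_i = 0.
Proof.
case/andP=> le_i lt_i; rewrite symmetric_formC.
apply: (form_kerP c p`_i _); apply: (basis_mem (geb_ker hp)).
rewrite -(subnKC le_i) -nth_drop mem_nth // size_drop size_tuple.
exact: ltn_sub2r (leq_ltn_trans le_i lt_i) lt_i.
Qed.

(** Expand the second argument of c(k, _) in the basis. *)
Lemma form_ker_basisP (R : realType) (V : vectType R) (c : {symmetric V})
    (n : nat) (p : n.-tuple V) (k : V) :
  basis_of fullv p -> (forall i, (i < n)%N -> c k p`_i = 0) ->
  k \in form_ker c.
Proof.
move=> pB k0; apply/form_kerP => w.
rewrite (coord_basis pB (memvf w)) linear_sumr big1 // => i _.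
by rewrite linearZr_LR /= k0 ?mulr0.
Qed.

(** Pi acts on coefficients as a truncation because c(p_j, p_i) is the
    Kronecker symbol as soon as j < n - s, even when p_i lies in ker c. With
    m = n - s it identifies the remainder k of the expansion of a vector; with
    smaller m, the coefficients of v - Pi v. *)
Lemma c_eig_proj (R : realType) (V : vectType R) (b c : {symmetric V})
    (n s : nat) (lam : (n - s).-tuple R) (p : n.-tuple V)
    (hp : gen_eigenbasis b c lam p) (m i : nat) (v : V) :
  (m <= n - s)%N -> (i < n)%N ->
  c (eig_proj c p m v) p`_i = if (i < m)%N then c v p`_i else 0.
Proof.
move=> le_m lt_i; rewrite eig_proj_forml.
rewrite (eq_bigr (fun j : 'I_m => if j == i :> nat then c v p`_i else 0)).
  case: ltnP => [lt_im|le_mi].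
    by rewrite -big_mkcond (big_pred1 (Ordinal lt_im)).
  by rewrite big1 // => j _; rewrite ltn_eqF // (leq_trans _ le_mi).
move=> j _; rewrite (geb_c hp) ?(leq_trans (ltn_ord j)) //.
by case: eqP => [->|_]; rewrite ?mulr1 ?mulr0.
Qed.

(** The coefficients of k with index below n - s are removed by the
    subtraction; those with larger index already vanish for w and for its
    projection. *)
Lemma eig_remainder_ker (R : realType) (V : vectType R) (b c : {symmetric V})
    (n s : nat) (lam : (n - s).-tuple R) (p : n.-tuple V)
    (hp : gen_eigenbasis b c lam p) (w : V) :
  w - eig_proj c p (n - s) w \in form_ker c.
Proof.
apply: (form_ker_basisP (geb_basis hp)) => i lt_i.
rewrite linearBl /= (c_eig_proj hp) //.
case: ltnP => [_|le_i]; first by rewrite subrr.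
by rewrite subr0 (c_ker_tail hp) // le_i.
Qed.

Lemma c_diagE (R : realType) (V : vectType R) (b c : {symmetric V})
    (n s : nat) (lam : (n - s).-tuple R) (p : n.-tuple V)
    (hp : gen_eigenbasis b c lam p) (w : V) :
  c w w = \sum_(j < n - s) c w p`_j ^+ 2.
Proof.
have /form_kerP k0 := eig_remainder_ker hp w.
rewrite -{1}(subrK (eig_proj c p (n - s) w) w) linearDl /= k0 add0r.
rewrite eig_proj_forml; apply: eq_bigr => j _.
by rewrite [c p`_j w]symmetric_formC expr2.
Qed.

(** The cross terms b(p_j, k) vanish because the eigenvector equation trades
    b for c, and k is in ker c; b may be indefinite, so unlike for c the square
    b(k, k) stays. *)
Lemma b_diagE (R : realType) (V : vectType R) (b c : {symmetric V})
    (n s : nat) (lam : (n - s).-tuple R) (p : n.-tuple V)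
    (hp : gen_eigenbasis b c lam p) (w : V) :
  let k := w - eig_proj c p (n - s) w in
  b w w = \sum_(j < n - s) lam`_j * c w p`_j ^+ 2 + b k k.
Proof.
move=> k; have /form_kerP k0 := eig_remainder_ker hp w.
have bek : b k (eig_proj c p (n - s) w) = 0.
  rewrite symmetric_formC eig_proj_forml big1 // => j _.
  by rewrite (geb_eigen hp) // [c p`_j k]symmetric_formC k0 !mulr0.
have bkw : b k w = b k k.
  by rewrite -(subrK (eig_proj c p (n - s) w) w) linearDr /= bek addr0.
rewrite -{1}(subrK (eig_proj c p (n - s) w) w) linearDl /= bkw addrC.
congr (_ + _); rewrite eig_proj_forml; apply: eq_bigr => j _.
by rewrite (geb_eigen hp) // [c p`_j w]symmetric_formC expr2 mulrCA.
Qed.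

Unset Implicit Arguments.

Theorem proposition2p12 (R : realType) (V : vectType R) (n s : nat)
    (dimV : \dim (fullv : {vspace V}) = n)
    (c : {symmetric V})
    (c_psd : forall v : V, 0 <= c v v)
    (dim_ker : \dim (form_ker c) = s)
    (lt_s_n : (s < n)%N)
    (b : {symmetric V})
    (b_pd : (1 <= s)%N ->
      forall v : V, v \in form_ker c -> v != 0 -> 0 < b v v)
    (lam : (n - s).-tuple R) (p : n.-tuple V)
    (eigenbasis : gen_eigenbasis b c lam p)
    (m : nat) (m_range : (1 <= m <= n - s - 1)%N)
    (lam_gt0 : 0 < lam`_m) :
  forall v : V,
    c (v - eig_proj c p m v) (v - eig_proj c p m v) <=
      1 / lam`_m * b (v - eig_proj c p m v) (v - eig_proj c p m v).
Proof.
move=> v; set w := v - _.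
have lt_m : (m < n - s)%N.
  case/andP: m_range => _ le_m; apply: leq_ltn_trans le_m _.
  by rewrite subn1 ltn_predL subn_gt0.
(* For s = 0 the kernel is trivial, and only the case k = 0 occurs. *)
have b_ker_ge0 k : k \in form_ker c -> 0 <= b k k.
  move=> kK; have [->|k_neq0] := eqVneq k 0; first by rewrite linear0l.
  apply/ltW/b_pd => //; rewrite -dim_ker lt0n dimv_eq0.
  by apply: contraNneq k_neq0 => ker0; rewrite -memv0 -ker0.
have cw0 j : (j < m)%N -> c w p`_j = 0.
  move=> lt_j; rewrite /w linearBl /= (c_eig_proj eigenbasis).
  - by rewrite lt_j subrr.
  - exact: ltnW.
  - exact: leq_trans (ltn_trans lt_j lt_m) (leq_subr _ _).
rewrite mul1r [_^-1 * _]mulrC ler_pdivlMr // mulrC.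
rewrite (b_diagE eigenbasis).
rewrite (c_diagE eigenbasis) mulr_sumr.
rewrite ler_wpDr ?b_ker_ge0 ?(eig_remainder_ker eigenbasis) //.
apply: ler_sum => j _; have [lt_jm|le_mj] := ltnP j m.
  by rewrite cw0 // expr0n !mulr0.
apply: ler_wpM2r; first exact: sqr_ge0.
apply: (sorted_leq_nth le_trans le_refl 0 (geb_sorted eigenbasis)) => //;
  by rewrite inE size_tuple.
Qed.
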